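(* Let $I$ be an interval and let $h$ be a real-valued function on $I$ whose derivative $h'$ is completely monotonic on $I$. Let $f$ be logarithmically completely monotonic on $h(I)$. Then the composite function $x\mapsto f(h(x))$ is logarithmically completely monotonic on $I$.
   Context: A function $g$ is called completely monotonic on an interval $I$ if it has derivatives of all orders on $I$ and $(-1)^k g^{(k)}(x)\ge 0$ for all $x\in I$ and all integers $k\ge 0$. A positive function $f$ on an interval $I$ is called logarithmically completely monotonic on $I$ if it has derivatives of all orders on $I$ and $(-1)^n[\ln f(x)]^{(n)}\ge 0$ for all $x\in I$ and all $n\in\mathbb{N}=\{1,2,\dots\}$. *)

(* Defs.v *)
From Stdlib Require Import Reals Lra.
From Coquelicot Require Import Coquelicot.
Open Scope R_scope.

(* Open, closed, half-open, bounded or unbounded: exactly the order-convex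
   subsets of R. *)
Definition is_interval (I : R -> Prop) : Prop :=
  forall a b x : R, I a -> I b -> a <= x <= b -> I x.

(* Coquelicot's [is_derive] with [locally x] replaced by its trace on [D]: the
   usual derivative in the interior of an interval [D], the one-sided one at an
   endpoint belonging to [D].  Only the values of [g] on [D] matter. *)
Definition is_derive_on (D : R -> Prop) (g : R -> R) (x l : R) : Prop :=
  filterdiff g (within D (locally x)) (fun y : R => scal y l).

Lemma is_derive_on_interior (D : R -> Prop) (g : R -> R) (x l : R) :
  locally x D -> (is_derive_on D g x l <-> is_derive g x l).
Proof.
intros HD.
assert (E : forall P : R -> Prop, within D (locally x) P <-> locally x P).
{ intros P; split; intros HP.
  - refine (filter_imp _ _ _ (filter_and _ _ HD HP)); intros y [h1 h2]; exact (h2 h1).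
  - refine (filter_imp _ _ _ HP); intros y h _; exact h. }
split; intros [Hl H]; split; try exact Hl.
- intros y Hy eps; apply E, H; intros P HP; apply E, Hy, HP.
- intros y Hy eps; apply E, H; intros P HP; apply E, Hy, HP.
Qed.

Lemma is_derive_on_unique (D : R -> Prop) (g : R -> R) (x y l1 l2 : R) :
  is_interval D -> D x -> D y -> y <> x ->
  is_derive_on D g x l1 -> is_derive_on D g x l2 -> l1 = l2.
Proof.
intros ID Dx Dy yx [_ H1] [_ H2].
apply Req_lt_aux; intros eps.
assert (L : is_filter_lim (within D (locally x)) x).
{ intros P HP; refine (filter_imp _ _ _ HP); intros z h _; exact h. }
pose (e := mkposreal (eps / 4) ltac:(destruct eps; simpl; lra)).
destruct (H1 x L e) as [d1 K1]; destruct (H2 x L e) as [d2 K2].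
set (d := Rmin (Rmin d1 d2) (Rabs (y - x))).
assert (d0 : 0 < d).
{ unfold d; repeat apply Rmin_glb_lt; try apply cond_pos.
  apply Rabs_pos_lt; lra. }
assert (dl : d <= d1 /\ d <= d2 /\ d <= Rabs (y - x)).
{ unfold d; generalize (Rmin_l (Rmin d1 d2) (Rabs (y - x)))
    (Rmin_r (Rmin d1 d2) (Rabs (y - x))) (Rmin_l d1 d2) (Rmin_r d1 d2); lra. }
assert (Z : exists z, D z /\ Rabs (z - x) = d / 2).
{ destruct (Rlt_dec x y) as [h|h].
  - rewrite (Rabs_pos_eq (y - x)) in dl by lra.
    exists (x + d / 2); split; [apply (ID x y); auto; lra|].
    rewrite Rabs_pos_eq; lra.
  - rewrite (Rabs_left1 (y - x)) in dl by lra.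
    exists (x - d / 2); split; [apply (ID y x); auto; lra|].
    rewrite Rabs_left1; lra. }
destruct Z as [z [Dz Az]].
assert (B1 : ball x d1 z) by (change (Rabs (z - x) < d1); lra).
assert (B2 : ball x d2 z) by (change (Rabs (z - x) < d2); lra).
generalize (K1 z B1 Dz) (K2 z B2 Dz).
change (Rabs (g z - g x - (z - x) * l1) <= eps / 4 * Rabs (z - x) ->
        Rabs (g z - g x - (z - x) * l2) <= eps / 4 * Rabs (z - x) ->
        Rabs (l1 - l2) < eps).
intros A1 A2.
assert (A : Rabs (z - x) * Rabs (l1 - l2) <= Rabs (z - x) * (eps / 2)).
{ rewrite <- Rabs_mult.
  replace ((z - x) * (l1 - l2)) with
    ((g z - g x - (z - x) * l2) - (g z - g x - (z - x) * l1)) by ring.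
  eapply Rle_trans; [apply Rabs_triang|]; rewrite Rabs_Ropp; lra. }
apply Rmult_le_reg_l in A; [|lra].
generalize (cond_pos eps); lra.
Qed.

(* [G k] is a [k]-th derivative of [g] on [D].  By [is_derive_on_unique], [G] is
   determined on [D] when [D] is an interval with more than one point. *)
Definition is_derivatives_on (D : R -> Prop) (g : R -> R) (G : nat -> R -> R) :
    Prop :=
  (forall x : R, D x -> G 0%nat x = g x) /\
  (forall (k : nat) (x : R), D x -> is_derive_on D (G k) x (G (S k) x)).

Definition completely_monotonic (D : R -> Prop) (g : R -> R) : Prop :=
  exists G : nat -> R -> R,
    is_derivatives_on D g G /\
    (forall (k : nat) (x : R), D x -> 0 <= (-1) ^ k * G k x).

Definition log_completely_monotonic (D : R -> Prop) (f : R -> R) : Prop :=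
  (forall x : R, D x -> 0 < f x) /\
  (exists F : nat -> R -> R, is_derivatives_on D f F) /\
  (exists L : nat -> R -> R,
    is_derivatives_on D (fun x : R => ln (f x)) L /\
    (forall (n : nat) (x : R), (1 <= n)%nat -> D x -> 0 <= (-1) ^ n * L n x)).

(* Main.v *)
Require Import Defs.
From Stdlib Require Import Reals Lia.
From Coquelicot Require Import Coquelicot.
Open Scope R_scope.

(** The [n]-th derivative of a product [(F o h) w] is obtained by iterating
    [((F o h) w)' = (F' o h) (h' w) + (F o h) w'].  If [F, F', ...], [h', h'', ...]
    and [w, w', ...] alternate in sign, then both summands have the sign opposite
    to [(F o h) w], and [h' w] again has alternating derivatives.  Since
    [(ln o f o h)' = ((ln o f)' o h) h'], this applies with [F = (ln o f)'] and
    [w = h'], so the sign of [ln o f] itself, which is unknown, plays no role. *)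

(** * Calculus of derivatives relative to a set *)

Lemma within_locally_proper (D : R -> Prop) (x : R) :
  D x -> ProperFilter (within D (locally x)).
Proof.
intros Dx; split; [|apply within_filter, locally_filter].
intros P HP; exists x; exact (locally_singleton _ _ HP Dx).
Qed.

Lemma within_locally_lim (D : R -> Prop) (x : R) :
  is_filter_lim (within D (locally x)) x.
Proof. intros P HP; exact (filter_le_within D P HP). Qed.

(** [filterdiff] speaks of every limit of its filter, and a finer filter could have more of them.
    Properness of [G] makes limits unique, so [x] is the only one to check. *)
Lemma filterdiff_le (F G : (R -> Prop) -> Prop) {FG : ProperFilter G}
    (g l : R -> R) (x : R) :
  is_filter_lim F x -> filter_le G F -> filterdiff g F l -> filterdiff g G l.
Proof.
intros Fx GF [Hl H]; split; [exact Hl|].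
intros y Gy eps.
rewrite <- (is_filter_lim_unique x y (F := G)).
- apply GF, (H x Fx eps).
- intros P HP; apply GF, Fx, HP.
- exact Gy.
Qed.

Lemma is_derive_on_continuous (D : R -> Prop) (g : R -> R) (x l : R) :
  is_derive_on D g x l -> filterlim g (within D (locally x)) (locally (g x)).
Proof.
intros H; apply (filterdiff_continuous_aux (V := R_NormedModule) g).
- exists (fun y => scal y l); exact H.
- apply within_locally_lim.
Qed.

Lemma is_derive_on_eq (D : R -> Prop) (g : R -> R) (x l1 l2 : R) :
  l1 = l2 -> is_derive_on D g x l1 -> is_derive_on D g x l2.
Proof. intros <- H; exact H. Qed.

Lemma is_derive_on_plus (D : R -> Prop) (g1 g2 : R -> R) (x l1 l2 : R) :
  is_derive_on D g1 x l1 -> is_derive_on D g2 x l2 ->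
  is_derive_on D (fun y => g1 y + g2 y) x (l1 + l2).
Proof.
intros H1 H2; unfold is_derive_on.
eapply filterdiff_ext_lin.
- exact (filterdiff_plus_fct _ _ _ _ H1 H2).
- intros y; unfold scal, plus; simpl; unfold mult; simpl; ring.
Qed.

Lemma is_derive_on_mult (D : R -> Prop) (g1 g2 : R -> R) (x l1 l2 : R) :
  D x -> is_derive_on D g1 x l1 -> is_derive_on D g2 x l2 ->
  is_derive_on D (fun y => g1 y * g2 y) x (l1 * g2 x + g1 x * l2).
Proof.
intros Dx H1 H2.
assert (PF := within_locally_proper D x Dx).
(* Differentiating [mult] along the pair requires the pair to converge; continuity of both factors
   gives this. *)
assert (L : is_filter_lim
  (filtermap (fun y => (g1 y, g2 y)) (within D (locally x))) (g1 x, g2 x)).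
{ intros P [d HP].
  refine (filter_imp (fun y => ball (g1 x) d (g1 y) /\ ball (g2 x) d (g2 y))
    _ (fun y Hy => HP (g1 y, g2 y) Hy) (filter_and _ _ _ _)).
  - exact (is_derive_on_continuous _ _ _ _ H1 _ (locally_ball (g1 x) d)).
  - exact (is_derive_on_continuous _ _ _ _ H2 _ (locally_ball (g2 x) d)). }
unfold is_derive_on; eapply filterdiff_ext_lin.
- exact (filterdiff_comp_2 g1 g2 mult _ _
    (fun u v => plus (mult u (g2 x)) (mult (g1 x) v)) H1 H2
    (filterdiff_mult _ L Rmult_comm)).
- intros y; unfold scal, plus; simpl; unfold mult; simpl; ring.
Qed.

Lemma is_derive_on_comp (D : R -> Prop) (g h : R -> R) (x lg lh : R) :
  D x -> is_derive_on D h x lh -> is_derive_on (image_dir h D) g (h x) lg ->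
  is_derive_on D (fun y => g (h y)) x (lg * lh).
Proof.
intros Dx Hh Hg.
assert (PF := within_locally_proper D x Dx).
unfold is_derive_on; eapply filterdiff_ext_lin.
- refine (filterdiff_comp h g _ _ Hh (filterdiff_le _ _ _ _ _ _ _ Hg)).
  + apply within_locally_lim.
  (* By continuity, [h] carries the trace of [locally x] on [D] to a filter finer than the trace of
     [locally (h x)] on the image. *)
  + intros P HP.
    generalize (is_derive_on_continuous _ _ _ _ Hh _ HP); unfold filtermap, within.
    apply filter_imp; intros y Hy Dy; apply Hy; [exact Dy|].
    exists y; split; [reflexivity|exact Dy].
- intros y; unfold scal; simpl; unfold mult; simpl; ring.
Qed.

(** * Signs and iterated derivatives of products *)

Definition shift (G : nat -> R -> R) (n : nat) : R -> R := G (S n).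

Definition derivative_chain (D : R -> Prop) (G : nat -> R -> R) : Prop :=
  forall (n : nat) (x : R), D x -> is_derive_on D (G n) x (G (S n) x).

(* The shift [a] keeps the pattern stable under differentiation. *)
Definition alternating (D : R -> Prop) (a : nat) (G : nat -> R -> R) : Prop :=
  forall (n : nat) (x : R), D x -> 0 <= (-1) ^ (n + a) * G n x.

Lemma derivative_chain_shift (D : R -> Prop) (G : nat -> R -> R) :
  derivative_chain D G -> derivative_chain D (shift G).
Proof. intros H n; exact (H (S n)). Qed.

Lemma alternating_shift (D : R -> Prop) (a : nat) (G : nat -> R -> R) :
  alternating D a G -> alternating D (S a) (shift G).
Proof. intros H n x Dx; rewrite <- plus_n_Sm; exact (H (S n) x Dx). Qed.

(** The Leibniz formula without binomial coefficients: the product rule is applied first and the [m]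
    remaining derivatives are taken of each summand, so inductions must generalize over [G] and
    [K]. *)
Fixpoint prod_deriv (n : nat) (G K : nat -> R -> R) (x : R) : R :=
  match n with
  | O => G 0%nat x * K 0%nat x
  | S m => prod_deriv m (shift G) K x + prod_deriv m G (shift K) x
  end.

Lemma derivative_chain_prod (D : R -> Prop) (G K : nat -> R -> R) :
  derivative_chain D G -> derivative_chain D K ->
  derivative_chain D (fun n => prod_deriv n G K).
Proof.
intros HG HK n; revert G K HG HK; induction n as [|n IH]; intros G K HG HK x Dx.
- apply is_derive_on_mult; auto.
- apply is_derive_on_plus;
    [apply (IH (shift G) K) | apply (IH G (shift K))];
    auto using derivative_chain_shift.
Qed.

Lemma pow_sign_mult (a b : nat) (u v : R) :
  0 <= (-1) ^ a * u -> 0 <= (-1) ^ b * v -> 0 <= (-1) ^ (a + b) * (u * v).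
Proof.
intros Hu Hv; rewrite pow_add.
replace ((-1) ^ a * (-1) ^ b * (u * v))
  with (((-1) ^ a * u) * ((-1) ^ b * v)) by ring.
now apply Rmult_le_pos.
Qed.

(** Each summand shifts exactly one factor, which raises [a] or [b] by one and so absorbs the extra
    derivative. *)
Lemma alternating_prod (D : R -> Prop) (a b : nat) (G K : nat -> R -> R) :
  alternating D a G -> alternating D b K ->
  alternating D (a + b) (fun n => prod_deriv n G K).
Proof.
intros HG HK n; revert a b G K HG HK.
induction n as [|n IH]; intros a b G K HG HK x Dx; simpl prod_deriv.
- apply (pow_sign_mult a b); [exact (HG 0%nat x Dx) | exact (HK 0%nat x Dx)].
- rewrite Rmult_plus_distr_l; apply Rplus_le_le_0_compat.
  + replace (S n + (a + b))%nat with (n + (S a + b))%nat by lia.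
    apply IH; auto using alternating_shift.
  + replace (S n + (a + b))%nat with (n + (a + S b))%nat by lia.
    apply IH; auto using alternating_shift.
Qed.

(* The [n]-th derivative of [(F 0 o h) * W 0], where [H] lists the derivatives of
   [h] starting from the first one. *)
Fixpoint comp_deriv (h : R -> R) (H : nat -> R -> R) (n : nat)
    (F W : nat -> R -> R) (x : R) : R :=
  match n with
  | O => F 0%nat (h x) * W 0%nat x
  | S m => comp_deriv h H m (shift F) (fun k => prod_deriv k H W) x
           + comp_deriv h H m F (shift W) x
  end.

(** * Iterated derivatives of a composition *)

Section Composition.

Variables (D : R -> Prop) (h : R -> R) (H : nat -> R -> R).
Hypothesis h_deriv : forall x : R, D x -> is_derive_on D h x (H 0%nat x).
Hypothesis H_chain : derivative_chain D H.

Lemma derivative_chain_comp (F W : nat -> R -> R) :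
  derivative_chain (image_dir h D) F -> derivative_chain D W ->
  derivative_chain D (fun n => comp_deriv h H n F W).
Proof using h_deriv H_chain.
intros HF HW n; revert F W HF HW; induction n as [|n IH]; intros F W HF HW x Dx.
(* Chain rule inside product rule; regrouping moves the factor [H 0] into the weight. *)
- apply is_derive_on_eq with
    (F 1%nat (h x) * H 0%nat x * W 0%nat x + F 0%nat (h x) * W 1%nat x).
  { simpl; unfold shift; ring. }
  apply (is_derive_on_mult D (fun y => F 0%nat (h y))); auto.
  apply is_derive_on_comp; auto.
  apply HF; exists x; auto.
- apply is_derive_on_plus;
    [apply (IH (shift F) (fun k => prod_deriv k H W)) | apply (IH F (shift W))];
    auto using derivative_chain_shift, derivative_chain_prod.
Qed.

Lemma alternating_comp (a b : nat) (F W : nat -> R -> R) :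
  alternating D 0 H -> alternating (image_dir h D) a F -> alternating D b W ->
  alternating D (a + b) (fun n => comp_deriv h H n F W).
Proof using Type.
intros HH HF HW n; revert a b F W HF HW.
induction n as [|n IH]; intros a b F W HF HW x Dx; simpl comp_deriv.
- apply (pow_sign_mult a b); [|exact (HW 0%nat x Dx)].
  apply (HF 0%nat); exists x; auto.
- rewrite Rmult_plus_distr_l; apply Rplus_le_le_0_compat.
  + replace (S n + (a + b))%nat with (n + (S a + b))%nat by lia.
    apply IH; auto using alternating_shift.
    (* The new weight keeps the shift [b], since [H] has shift 0. *)
    exact (alternating_prod D 0 b H W HH HW).
  + replace (S n + (a + b))%nat with (n + (a + S b))%nat by lia.
    apply IH; auto using alternating_shift.
Qed.

(** Order 0 stands apart: from order 1 on, these are the derivatives of [F 1] composed with [h],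
    weighted by [H 0]. *)
Definition composite_derivatives (F : nat -> R -> R) (n : nat) (x : R) : R :=
  match n with
  | O => F 0%nat (h x)
  | S m => comp_deriv h H m (shift F) H x
  end.

Lemma is_derivatives_on_comp (g : R -> R) (F : nat -> R -> R) :
  is_derivatives_on (image_dir h D) g F ->
  is_derivatives_on D (fun x => g (h x)) (composite_derivatives F).
Proof using h_deriv H_chain.
intros [F0 HF]; split.
- intros x Dx; apply F0; exists x; auto.
- intros [|n] x Dx.
  + apply (is_derive_on_comp D (F 0%nat)); auto.
    apply HF; exists x; auto.
  + apply (derivative_chain_comp (shift F) H); auto.
    exact (derivative_chain_shift _ _ HF).
Qed.

End Composition.

Theorem theorem8 (I : R -> Prop) (h h' f : R -> R) (HI : is_interval I)
  (Hh : forall x : R, I x -> is_derive_on I h x (h' x))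
  (Hh' : completely_monotonic I h')
  (Hf : log_completely_monotonic (image_dir h I) f) :
  log_completely_monotonic I (fun x : R => f (h x)).
Proof.
destruct Hh' as [H [[H0 H_chain] H_sign]].
destruct Hf as [f_pos [[F HF] [L [HL L_sign]]]].
assert (h_deriv : forall x, I x -> is_derive_on I h x (H 0%nat x)).
{ intros x Ix; rewrite H0; auto. }
split; [|split].
- intros x Ix; apply f_pos; exists x; auto.
- exists (composite_derivatives h H F); now apply is_derivatives_on_comp.
- exists (composite_derivatives h H L); split.
  + now apply (is_derivatives_on_comp I h H h_deriv H_chain (fun y => ln (f y))).
  + intros [|n] x Hn Ix; [lia|].
    (* Shift 1 belongs to the derivatives of [ln f] from the first on, shift 0 to the weight [H]. *)
    replace (S n) with (n + (1 + 0))%nat at 1 by lia.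
    apply (alternating_comp I h H 1 0 (shift L) H); auto.
    * intros k y Iy; rewrite Nat.add_0_r; auto.
    * intros k y Jy; rewrite Nat.add_1_r; apply L_sign; [lia|exact Jy].
    * intros k y Iy; rewrite Nat.add_0_r; auto.
Qed.
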